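(* When applied to the operator $Q=\Delta=\partial_x^2+\partial_y^2$ on a Cartesian grid, the LCBC approach on a face (defined in the context), at any order $2p=2,4,6,\dots$, results in numerical boundary conditions with odd symmetry for the case of homogeneous Dirichlet boundary conditions and with even symmetry for the case of homogeneous Neumann boundary conditions. For example, $$U_{i-\hat i,j}=-U_{i+\hat i,j},\quad \hat i=1,\dots,p,\qquad\text{Dirichlet boundary condition at } i=0 \text{ or } i=N_x,$$ $$U_{i-\hat i,j}=U_{i+\hat i,j},\quad \hat i=1,\dots,p,\qquad\text{Neumann boundary condition at } i=0 \text{ or } i=N_x.$$
   Context: LCBC = Local Compatibility Boundary Condition. The PDE is $\mathcal L_q u=Qu+f$ with $\mathcal L_0u=0$, $\mathcal L_1u=\partial_tu$, $\mathcal L_2u=\partial_t^2u$, on the unit square with Cartesian grid points $\mathbf x_{i,j}=(i\Delta x,j\Delta y)$, $0\le i\le N_x$, $0\le j\le N_y$, extended by $p$ lines of ghost points outside each face. $U_{i,j}$ denotes the grid function at a fixed time $t$. The boundary condition on the left face $x=0$ is $u=g_\ell(y,t)$ (Dirichlet) or $\partial_xu=g_\ell(y,t)$ (Neumann); it is homogeneous when $g_\ell=0$. At a boundary point $(0,\tilde y)=\mathbf x_{0,\tilde j}$ of the left face away from the corners, $\tilde j\in\{p,\dots,N_y-p\}$, let $\tilde u$ be a polynomial in $(x,y)$ of degree at most $2p$ in each variable satisfying the following constraints. Dirichlet: - $\tilde u(0,\tilde y+\hat j\Delta y)=g_\ell(\tilde y+\hat j\Delta y,t)$ for $\hat j=-p,\dots,p$;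 - $\tilde u(\hat i\Delta x,\tilde y+\hat j\Delta y)=U_{\hat i,\tilde j+\hat j}$ for $\hat i=1,\dots,p$, $\hat j=-p,\dots,p$; - compatibility conditions $\partial_y^{\mu}Q^{\nu}\tilde u(0,\tilde y)=\partial_y^\mu R_{\ell,\nu}(\tilde y,t)$ for $\nu=1,\dots,p$, $\mu=0,\dots,2p$, where $R_{\ell,\nu}=-Q^{\nu-1}f(0,y)$ if $q=0$ and $R_{\ell,\nu}=\partial_t^{q\nu}g_\ell-\Psi_\nu f(0,y,t)$ if $q=1,2$, with $\Psi_\nu f=\sum_{k=1}^{\nu}Q^{k-1}\partial_t^{q(\nu-k)}f$. Neumann: - $\tilde u(\hat i\Delta x,\tilde y+\hat j\Delta y)=U_{\hat i,\tilde j+\hat j}$ for $\hat i=0,1,\dots,p$, $\hat j=-p,\dots,p$; - conditions $\partial_y^{\mu}\partial_xQ^{\nu}\tilde u(0,\tilde y)=\partial_y^\mu S_{\ell,\nu}(\tilde y,t)$ for $\nu=0,\dots,p-1$, $\mu=0,\dots,2p$, where $S_{\ell,0}=g_\ell$ and, for $\nu\ge1$, $S_{\ell,\nu}=-\partial_xQ^{\nu-1}f(0,y)$ if $q=0$ and $S_{\ell,\nu}=\partial_t^{q\nu}g_\ell-\partial_x\Psi_\nu f(0,y,t)$ if $q=1,2$. The ghost values are then $U_{-\hat i,\tilde j}=\tilde u(-\hat i\Delta x,\tilde y)$, $\hat i=1,\dots,p$. The other faces are treated in the same way, with data points always on the interior side.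
   Formalization: The forcing f is assumed to vanish identically, in addition to homogeneous boundary data; otherwise the claim fails, e.g. for Dirichlet with p=1 one gets U_{-1,j}+U_{1,j} = -Δx² f(0,y_j,t). *)

(* Defs.v *)
(* Stdlib reals with Coquelicot. *)
From Stdlib Require Import Reals ZArith.
From Coquelicot Require Import Coquelicot.
Open Scope R_scope.

Inductive face := Left | Right | Bottom | Top.

Inductive bc_kind := Dirichlet | Neumann.

Definition laplacian (v : R -> R -> R) : R -> R -> R :=
  fun x y => Derive_n (fun z => v z y) 2 x + Derive_n (fun z => v x z) 2 y.

(* Restriction of [v] to the face, as a function of the tangential coordinate:
   [y] on the left and right faces, [x] on the bottom and top faces. *)
Definition trace (F : face) (v : R -> R -> R) (s : R) : R :=
  match F with
  | Left => v 0 s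
  | Right => v 1 s
  | Bottom => v s 0
  | Top => v s 1
  end.

(* Derivative across the face, always along the positive coordinate axis:
   it is not the outward normal derivative. *)
Definition Dcross (F : face) (v : R -> R -> R) : R -> R -> R :=
  match F with
  | Left | Right => fun x y => Derive (fun z => v z y) x
  | Bottom | Top => fun x y => Derive (fun z => v x z) y
  end.

(* Index of the grid point on the [n]-th grid line from the face, counted
   towards the interior ([n < 0] gives ghost points), at tangential index [k]. *)
Definition node (F : face) (Nx Ny : nat) (n k : Z) : Z * Z :=
  match F with
  | Left => (n, k)
  | Right => (Z.of_nat Nx - n, k)%Z
  | Bottom => (k, n)
  | Top => (k, Z.of_nat Ny - n)%Z
  end.

Definition tangential_size (F : face) (Nx Ny : nat) : nat :=
  match F with Left | Right => Ny | Bottom | Top => Nx end.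

Definition coord (N : nat) (i : Z) : R := IZR i * (1 / INR N).

Definition tangential_coord (F : face) (Nx Ny : nat) (k : Z) : R :=
  coord (tangential_size F Nx Ny) k.

Definition value_at (Nx Ny : nat) (v : R -> R -> R) (P : Z * Z) : R :=
  v (coord Nx (fst P)) (coord Ny (snd P)).

Definition grid_value (U : Z -> Z -> R) (P : Z * Z) : R := U (fst P) (snd P).

Definition is_bipoly (d : nat) (v : R -> R -> R) : Prop :=
  exists c : nat -> nat -> R, forall x y : R,
    v x y = sum_f_R0 (fun m => sum_f_R0 (fun n => c m n * x ^ m * y ^ n) d) d.

Section LCBC.

(* The equation is [L_q u = Q u + f], where [L_0 u = 0] and [L_q] is the [q]-th
   time derivative for [q = 1, 2].  The operator [Q] acts on functions of
   [(x, y)]; [f] takes [(x, y, t)] and [g] takes (tangential coordinate, t).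
   When [q = 0], [t] is a mere parameter. *)
Variables (Q : (R -> R -> R) -> R -> R -> R) (q : nat).
Variables (f : R -> R -> R -> R) (F : face) (g : R -> R -> R).

Definition Psi (nu : nat) (t : R) : R -> R -> R :=
  fun x y =>
    sum_n_m
      (fun k => Nat.iter (k - 1) Q
                  (fun x' y' => Derive_n (fun s => f x' y' s) (q * (nu - k)) t)
                  x y)
      1 nu.

Definition dirichlet_data (nu : nat) (t s : R) : R :=
  match q with
  | O => - trace F (Nat.iter (nu - 1) Q (fun x y => f x y t)) s
  | _ => Derive_n (fun t' => g s t') (q * nu) t - trace F (Psi nu t) s
  end.

Definition neumann_data (nu : nat) (t s : R) : R :=
  match nu, q with
  | O, _ => g s t
  | _, O => - trace F (Dcross F (Nat.iter (nu - 1) Q (fun x y => f x y t))) s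
  | _, _ => Derive_n (fun t' => g s t') (q * nu) t
            - trace F (Dcross F (Psi nu t)) s
  end.

Variables (p Nx Ny : nat) (t : R) (U : Z -> Z -> R) (k : Z).

Definition dirichlet_constraints (u : R -> R -> R) : Prop :=
  (forall j : Z, (- Z.of_nat p <= j <= Z.of_nat p)%Z ->
     value_at Nx Ny u (node F Nx Ny 0 (k + j))
       = g (tangential_coord F Nx Ny (k + j)) t)
  /\ (forall i j : Z, (1 <= i <= Z.of_nat p)%Z ->
       (- Z.of_nat p <= j <= Z.of_nat p)%Z ->
       value_at Nx Ny u (node F Nx Ny i (k + j))
         = grid_value U (node F Nx Ny i (k + j)))
  /\ (forall nu mu : nat, (1 <= nu <= p)%nat -> (mu <= 2 * p)%nat ->
       Derive_n (trace F (Nat.iter nu Q u)) mu (tangential_coord F Nx Ny k)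
         = Derive_n (dirichlet_data nu t) mu (tangential_coord F Nx Ny k)).

Definition neumann_constraints (u : R -> R -> R) : Prop :=
  (forall i j : Z, (0 <= i <= Z.of_nat p)%Z ->
     (- Z.of_nat p <= j <= Z.of_nat p)%Z ->
     value_at Nx Ny u (node F Nx Ny i (k + j))
       = grid_value U (node F Nx Ny i (k + j)))
  /\ (forall nu mu : nat, (nu < p)%nat -> (mu <= 2 * p)%nat ->
       Derive_n (trace F (Dcross F (Nat.iter nu Q u))) mu
           (tangential_coord F Nx Ny k)
         = Derive_n (neumann_data nu t) mu (tangential_coord F Nx Ny k)).

Definition lcbc_polynomial (b : bc_kind) (u : R -> R -> R) : Prop :=
  is_bipoly (2 * p) u
  /\ match b with
     | Dirichlet => dirichlet_constraints u
     | Neumann => neumann_constraints u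
     end.

(* The ghost values of [U] on the grid line through the boundary point of
   tangential index [k] are those assigned by the LCBC approach. *)
Definition lcbc_ghost_values (b : bc_kind) : Prop :=
  exists u : R -> R -> R,
    lcbc_polynomial b u
    /\ forall i : Z, (1 <= i <= Z.of_nat p)%Z ->
         grid_value U (node F Nx Ny (- i) k)
           = value_at Nx Ny u (node F Nx Ny (- i) k).

End LCBC.

(* Main.v *)
Require Import Defs.
From Stdlib Require Import Reals ZArith Lra Lia FunctionalExtensionality ClassicalEpsilon.
From Coquelicot Require Import Coquelicot.
Open Scope R_scope.

(** The polynomial [u] has degree at most [2p] in the tangential variable, so its
    [2p+1] interpolation conditions on the face, and the [2p+1] tangential
    derivatives in each compatibility condition, make [u] and all [Delta^nu u]
    (for Neumann, all [dn Delta^nu u]) vanish identically along the face line.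
    Since tangential derivatives then vanish there as well, [Delta] can be traded
    for [dn^2]: all even (odd) normal derivatives of [u] vanish on the face, and,
    the degree in the normal variable being at most [2p], [u] is odd (even)
    across it. *)

(** * Polynomials in one variable: zeros, Taylor data and parity *)

Lemma Derive_n_zero (m : nat) (x : R) : Derive_n (fun _ => 0) m x = 0.
Proof.
  revert x; induction m as [|m IH]; intros x; simpl; [reflexivity|].
  rewrite (Derive_ext _ (fun _ => 0) x IH); apply Derive_const.
Qed.

Lemma Derive_n_Derive (h : R -> R) (m : nat) (x : R) :
  Derive_n (Derive h) m x = Derive_n h (S m) x.
Proof.
  revert x; induction m as [|m IH]; intros x; [reflexivity|].
  simpl; apply Derive_ext; intros y; apply IH.
Qed.

Lemma constant_of_Derive_zero (h : R -> R) :
  (forall x, ex_derive h x) -> (forall x, Derive h x = 0) ->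
  forall x y, h x = h y.
Proof.
  intros Hd H0 x y.
  destruct (MVT_gen h y x (Derive h)) as [c [_ Hc]].
  - intros z _; apply Derive_correct, Hd.
  - intros z _; apply continuity_pt_filterlim.
    exact (ex_derive_continuous h z (Hd z)).
  - rewrite H0 in Hc; lra.
Qed.

(* Polynomials of degree less than [n]: the [n]-th derivative vanishes. *)
Fixpoint is_poly (n : nat) (h : R -> R) : Prop :=
  match n with
  | O => forall x, h x = 0
  | S n => (forall x, ex_derive h x) /\ is_poly n (Derive h)
  end.

Lemma is_poly_ext (n : nat) (h1 h2 : R -> R) :
  (forall x, h1 x = h2 x) -> is_poly n h1 -> is_poly n h2.
Proof.
  intros E; replace h2 with h1; [easy|].
  apply functional_extensionality, E.
Qed.

(** Raising the bound by one exposes the first clause of the definition. Differentiability and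
    closure under [Derive] thus hold for every [n], [n = 0] included. *)
Lemma is_poly_S (n : nat) (h : R -> R) : is_poly n h -> is_poly (S n) h.
Proof.
  revert h; induction n as [|n IH]; intros h Hh.
  - split; intros x.
    + apply (ex_derive_ext (fun _ => 0)); [easy|apply ex_derive_const].
    + rewrite (Derive_ext h (fun _ => 0) x Hh); apply Derive_const.
  - destruct Hh as [Hd Hh]; split; [exact Hd|exact (IH _ Hh)].
Qed.

Lemma is_poly_le (n m : nat) (h : R -> R) :
  (n <= m)%nat -> is_poly n h -> is_poly m h.
Proof. induction 1; [easy|]; intros; apply is_poly_S; auto. Qed.

Lemma is_poly_ex_derive (n : nat) (h : R -> R) (x : R) :
  is_poly n h -> ex_derive h x.
Proof. intros H; apply is_poly_S in H; apply H. Qed.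

Lemma is_poly_Derive (n : nat) (h : R -> R) :
  is_poly n h -> is_poly n (Derive h).
Proof. intros H; apply is_poly_S in H; apply H. Qed.

Lemma is_poly_plus (n : nat) (h1 h2 : R -> R) :
  is_poly n h1 -> is_poly n h2 -> is_poly n (fun x => h1 x + h2 x).
Proof.
  revert h1 h2; induction n as [|n IH]; simpl; intros h1 h2 H1 H2.
  - intros x; rewrite H1, H2; ring.
  - destruct H1 as [D1 H1], H2 as [D2 H2]; split.
    + intros x; exact (ex_derive_plus h1 h2 x (D1 x) (D2 x)).
    + apply (is_poly_ext n (fun x => Derive h1 x + Derive h2 x)); [|auto].
      intros x; symmetry; apply Derive_plus; auto.
Qed.

Lemma is_poly_scal (n : nat) (a : R) (h : R -> R) :
  is_poly n h -> is_poly n (fun x => a * h x).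
Proof.
  revert h; induction n as [|n IH]; simpl; intros h H.
  - intros x; rewrite H; ring.
  - destruct H as [D H]; split.
    + intros x; exact (ex_derive_scal h a x (D x)).
    + apply (is_poly_ext n (fun x => a * Derive h x)); [|auto].
      intros x; symmetry; apply Derive_scal.
Qed.

(** The constant [c] stays free for two uses: [c = 0] for parity about the origin, [c = 1] for the
    exchange of opposite faces. *)
Lemma is_derive_reflect (c : R) (h : R -> R) (x : R) :
  ex_derive h (c - x) ->
  is_derive (fun z => h (c - z)) x (- Derive h (c - x)).
Proof.
  intros H; auto_derive; [exact H|].
  change (fun z : R => h z) with h; unfold Rminus; ring.
Qed.

Lemma Derive_reflect (c : R) (h : R -> R) (x : R) :
  ex_derive h (c - x) ->
  Derive (fun z => h (c - z)) x = - Derive h (c - x).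
Proof. intros H; apply is_derive_unique, is_derive_reflect, H. Qed.

Lemma is_poly_reflect (n : nat) (c : R) (h : R -> R) :
  is_poly n h -> is_poly n (fun x => h (c - x)).
Proof.
  revert h; induction n as [|n IH]; simpl; intros h H.
  - intros x; apply H.
  - destruct H as [D H]; split.
    + intros x; eexists; apply is_derive_reflect, D.
    + apply (is_poly_ext n (fun x => -1 * Derive h (c - x))).
      * intros x; rewrite Derive_reflect by apply D; ring.
      * apply is_poly_scal, IH, H.
Qed.

Lemma is_poly_pow (m : nat) : is_poly (S m) (fun x => x ^ m).
Proof.
  induction m as [|m IH].
  - split; simpl; intros x; [apply ex_derive_const|apply Derive_const].
  - split.
    + intros x; auto_derive; easy.
    + apply (is_poly_ext (S m) (fun x => INR (S m) * x ^ m)).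
      * intros x; symmetry; apply is_derive_unique.
        auto_derive; [easy|]; rewrite Rmult_1_l; reflexivity.
      * apply is_poly_scal, IH.
Qed.

(** By induction [Derive h] vanishes, so [h] is constant, and its value at [a] is 0. This exploits
    the compatibility conditions, which prescribe tangential derivatives at a single point. *)
Lemma is_poly_eq_zero_taylor (n : nat) (h : R -> R) (a : R) :
  is_poly n h -> (forall m, (m < n)%nat -> Derive_n h m a = 0) ->
  forall x, h x = 0.
Proof.
  revert h; induction n as [|n IH]; intros h H H0; [exact H|].
  intros x; rewrite (constant_of_Derive_zero h (proj1 H)) with (y := a).
  - apply (H0 0%nat); lia.
  - apply IH; [apply H|].
    intros m Hm; rewrite Derive_n_Derive; apply H0; lia.
Qed.

(** Rolle's theorem and induction: between [n + 1] zeros of [h] lie [n] zeros of [Derive h]. The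
    points form an infinite increasing sequence, of which only the first [n] have to be zeros; this
    spares any handling of finite lists. *)
Lemma is_poly_eq_zero_roots (n : nat) (h : R -> R) (r : nat -> R) :
  is_poly n h -> (forall i, r i < r (S i)) ->
  (forall i, (i < n)%nat -> h (r i) = 0) -> forall x, h x = 0.
Proof.
  revert h r; induction n as [|n IH]; intros h r H Hr H0; [exact H|].
  (* The mean value theorem gives an intermediate point for every [i]; the derivative is claimed to
     vanish there only when both endpoints are among the known zeros. *)
  assert (Hc : forall i, exists c,
             (r i < c < r (S i)) /\ ((S i < S n)%nat -> Derive h c = 0)).
  { intros i; destruct (MVT_cor2 h (Derive h) _ _ (Hr i)) as [c [E Hc]].
    - intros c _; apply is_derive_Reals, Derive_correct, H.
    - exists c; split; [exact Hc|]; intros Hi.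
      rewrite !H0 in E by lia; pose proof (Hr i).
      destruct (Rmult_integral (Derive h c) (r (S i) - r i)); lra. }
  (* The chosen points interlace with [r], hence increase strictly, as the induction hypothesis
     demands. *)
  set (r' i := proj1_sig (constructive_indefinite_description _ (Hc i))).
  assert (Hr' : forall i, (r i < r' i < r (S i)) /\
                          ((S i < S n)%nat -> Derive h (r' i) = 0))
    by (intros i; exact (proj2_sig (constructive_indefinite_description _ (Hc i)))).
  intros x; rewrite (constant_of_Derive_zero h (proj1 H)) with (y := r 0%nat).
  - apply H0; lia.
  - apply (IH _ r'); [apply H| |].
    + intros i; destruct (Hr' i), (Hr' (S i)); lra.
    + intros i Hi; apply Hr'; lia.
Qed.

Lemma Derive_n_reflect (n : nat) (h : R -> R) (m : nat) (x : R) :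
  is_poly n h ->
  Derive_n (fun z => h (0 - z)) m x = (-1) ^ m * Derive_n h m (0 - x).
Proof.
  revert h; induction m as [|m IH]; intros h H; [simpl; ring|].
  rewrite <- !Derive_n_Derive.
  rewrite (Derive_n_ext _ (fun z => -1 * Derive h (0 - z))).
  - rewrite Derive_n_scal_l, IH by (apply is_poly_Derive, H); simpl; ring.
  - intros y; rewrite Derive_reflect by apply (is_poly_ex_derive n h _ H); ring.
Qed.

Lemma is_poly_ex_derive_n (n : nat) (h : R -> R) (m : nat) (x : R) :
  is_poly n h -> ex_derive_n h m x.
Proof.
  destruct m as [|m]; [easy|]; revert h x.
  induction m as [|m IH]; intros h x H.
  - apply (is_poly_ex_derive n), H.
  - apply (ex_derive_ext (Derive_n (Derive h) m)).
    + intros y; apply Derive_n_Derive.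
    + apply (IH (Derive h)), is_poly_Derive, H.
Qed.

(** Here [e = 0] yields an odd function and [e = 1] an even one. The [m]-th derivative at 0 of
    [h x + (-1)^e * h (- x)] is [1 + (-1)^(m + e)] times that of [h]: the factor is 0 if [m + e] is
    odd, and otherwise the derivative of [h] is 0 by hypothesis. All Taylor data vanish, hence so
    does the sum. *)
Lemma is_poly_parity (n : nat) (h : R -> R) (e : nat) :
  is_poly n h ->
  (forall m, (2 * m + e < n)%nat -> Derive_n h (2 * m + e) 0 = 0) ->
  (e <= 1)%nat ->
  forall x, h (- x) = - (-1) ^ e * h x.
Proof.
  intros H H0 He x.
  enough (E : h x + (-1) ^ e * h (0 - x) = 0).
  { rewrite Rminus_0_l in E; destruct e as [|[|]]; [| |lia]; simpl in *; lra. }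
  apply (is_poly_eq_zero_taylor n (fun z => h z + (-1) ^ e * h (0 - z)) 0).
  - apply is_poly_plus; [exact H|]; apply is_poly_scal, is_poly_reflect, H.
  - intros m Hm.
    rewrite Derive_n_plus, Derive_n_scal_l, (Derive_n_reflect n), Rminus_0_r.
    + destruct (Nat.Even_or_Odd m) as [[l ->]|[l ->]].
      * rewrite pow_1_even; destruct e as [|[|]]; [| |lia]; simpl pow; [|ring].
        rewrite <- (Nat.add_0_r (2 * l)), H0 by lia; ring.
      * rewrite (Nat.add_1_r (2 * l)), pow_1_odd, <- Nat.add_1_r.
        destruct e as [|[|]]; [| |lia]; simpl pow; [ring|].
        rewrite H0 by lia; ring.
    + exact H.
    + apply filter_forall; intros y l _; apply (is_poly_ex_derive_n n), H.
    + apply filter_forall; intros y l _; apply (is_poly_ex_derive_n n).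
      apply is_poly_scal, is_poly_reflect, H.
Qed.

(** * Polynomials in two variables and powers of the Laplacian *)

Definition Dx (v : R -> R -> R) : R -> R -> R :=
  fun x y => Derive (fun z => v z y) x.

Definition Dy (v : R -> R -> R) : R -> R -> R :=
  fun x y => Derive (fun z => v x z) y.

Definition add2 (v w : R -> R -> R) : R -> R -> R := fun x y => v x y + w x y.

Lemma fun2_ext (v w : R -> R -> R) : (forall x y, v x y = w x y) -> v = w.
Proof.
  intros H; apply functional_extensionality; intros x.
  apply functional_extensionality, H.
Qed.

(** Finite sums of tensor products instead of coefficient arrays: facts on slices and partial
    derivatives reduce by induction to one variable. The degree is less than [n] in each variable
    separately. *)
Inductive bipoly (n : nat) : (R -> R -> R) -> Prop :=
| bipoly_tensor (a b : R -> R) :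
    is_poly n a -> is_poly n b -> bipoly n (fun x y => a x * b y)
| bipoly_add (v w : R -> R -> R) :
    bipoly n v -> bipoly n w -> bipoly n (add2 v w).

Lemma bipoly_swap (n : nat) (v : R -> R -> R) :
  bipoly n v -> bipoly n (fun x y => v y x).
Proof.
  induction 1 as [a b Ha Hb|v w _ IHv _ IHw].
  - replace (fun x y => a y * b x) with (fun x y => b x * a y).
    + now constructor.
    + apply fun2_ext; intros; ring.
  - exact (bipoly_add n _ _ IHv IHw).
Qed.

Lemma bipoly_slice_x (n : nat) (v : R -> R -> R) (y : R) :
  bipoly n v -> is_poly n (fun x => v x y).
Proof.
  induction 1 as [a b Ha Hb|v w _ IHv _ IHw].
  - apply (is_poly_ext n (fun x => b y * a x)); [intros; ring|].
    now apply is_poly_scal.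
  - now apply is_poly_plus.
Qed.

Lemma bipoly_slice_y (n : nat) (v : R -> R -> R) (x : R) :
  bipoly n v -> is_poly n (fun y => v x y).
Proof. intros H; exact (bipoly_slice_x n _ x (bipoly_swap n v H)). Qed.

Lemma bipoly_ex_derive_x (n : nat) (v : R -> R -> R) (x y : R) :
  bipoly n v -> ex_derive (fun z => v z y) x.
Proof. intros H; apply (is_poly_ex_derive n), bipoly_slice_x, H. Qed.

Lemma bipoly_ex_derive_y (n : nat) (v : R -> R -> R) (x y : R) :
  bipoly n v -> ex_derive (fun z => v x z) y.
Proof. intros H; apply (is_poly_ex_derive n), bipoly_slice_y, H. Qed.

Lemma Dx_add2 (n : nat) (v w : R -> R -> R) :
  bipoly n v -> bipoly n w -> Dx (add2 v w) = add2 (Dx v) (Dx w).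
Proof.
  intros Hv Hw; apply fun2_ext; intros x y; unfold Dx, add2.
  apply Derive_plus; eapply bipoly_ex_derive_x; eassumption.
Qed.

Lemma Dy_add2 (n : nat) (v w : R -> R -> R) :
  bipoly n v -> bipoly n w -> Dy (add2 v w) = add2 (Dy v) (Dy w).
Proof.
  intros Hv Hw; apply fun2_ext; intros x y; unfold Dy, add2.
  apply Derive_plus; eapply bipoly_ex_derive_y; eassumption.
Qed.

Lemma Dx_tensor (a b : R -> R) :
  Dx (fun x y => a x * b y) = fun x y => Derive a x * b y.
Proof.
  apply fun2_ext; intros x y; unfold Dx; apply Derive_scal_l.
Qed.

Lemma Dy_tensor (a b : R -> R) :
  Dy (fun x y => a x * b y) = fun x y => a x * Derive b y.
Proof.
  apply fun2_ext; intros x y; unfold Dy; apply Derive_scal.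
Qed.

Lemma bipoly_Dx (n : nat) (v : R -> R -> R) : bipoly n v -> bipoly n (Dx v).
Proof.
  induction 1 as [a b Ha Hb|v w Hv IHv Hw IHw].
  - rewrite Dx_tensor; constructor; [apply is_poly_Derive|]; assumption.
  - rewrite (Dx_add2 n) by assumption; now constructor.
Qed.

Lemma bipoly_Dy (n : nat) (v : R -> R -> R) : bipoly n v -> bipoly n (Dy v).
Proof.
  intros H; exact (bipoly_swap n _ (bipoly_Dx n _ (bipoly_swap n v H))).
Qed.

(** On a tensor product both sides are the product of the two derivatives, and both are additive; no
    continuity of mixed partials has to be discussed. *)
Lemma Dx_Dy (n : nat) (v : R -> R -> R) : bipoly n v -> Dx (Dy v) = Dy (Dx v).
Proof.
  induction 1 as [a b Ha Hb|v w Hv IHv Hw IHw].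
  - now rewrite Dy_tensor, !Dx_tensor, Dy_tensor.
  - pose proof (bipoly_Dx n v Hv); pose proof (bipoly_Dx n w Hw).
    pose proof (bipoly_Dy n v Hv); pose proof (bipoly_Dy n w Hw).
    rewrite (Dy_add2 n), !(Dx_add2 n), (Dy_add2 n) by assumption.
    now rewrite IHv, IHw.
Qed.

Lemma laplacian_eq (v : R -> R -> R) :
  laplacian v = add2 (Dx (Dx v)) (Dy (Dy v)).
Proof. reflexivity. Qed.

Lemma bipoly_laplacian (n : nat) (v : R -> R -> R) :
  bipoly n v -> bipoly n (laplacian v).
Proof.
  intros H; rewrite laplacian_eq; constructor;
    [apply bipoly_Dx, bipoly_Dx, H|apply bipoly_Dy, bipoly_Dy, H].
Qed.

Lemma bipoly_iter_laplacian (n nu : nat) (v : R -> R -> R) :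
  bipoly n v -> bipoly n (Nat.iter nu laplacian v).
Proof. intros H; induction nu; simpl; [|apply bipoly_laplacian]; assumption. Qed.

Lemma laplacian_Dx (n : nat) (v : R -> R -> R) :
  bipoly n v -> laplacian (Dx v) = Dx (laplacian v).
Proof.
  intros H; rewrite !laplacian_eq, (Dx_add2 n), !(Dx_Dy n);
    repeat (apply bipoly_Dx || apply bipoly_Dy); try easy.
Qed.

Lemma iter_laplacian_Dx (n nu : nat) (v : R -> R -> R) :
  bipoly n v ->
  Nat.iter nu laplacian (Dx v) = Dx (Nat.iter nu laplacian v).
Proof.
  intros H; induction nu as [|nu IH]; [reflexivity|].
  simpl; rewrite IH; apply (laplacian_Dx n), bipoly_iter_laplacian, H.
Qed.

Lemma Dy_Dy_zero_on_axis (v : R -> R -> R) :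
  (forall y, v 0 y = 0) -> forall y, Dy (Dy v) 0 y = 0.
Proof.
  intros H y; change (Derive_n (fun z => v 0 z) 2 y = 0).
  rewrite (Derive_n_ext _ (fun _ => 0)) by exact H; apply Derive_n_zero.
Qed.

(** Induction on [p], passing from [v] to [v_xx]. Since the Laplacian commutes with [Dx], [Delta^nu
    v_xx = Delta^(nu+1) v - (Delta^nu v)_yy]. Both terms on the right vanish on the axis, the second
    because [Delta^nu v] is zero all along it. One power of the Laplacian is spent per step. *)
Lemma Derive_even_zero_on_axis (n p : nat) (v : R -> R -> R) :
  bipoly n v ->
  (forall nu y, (nu <= p)%nat -> Nat.iter nu laplacian v 0 y = 0) ->
  forall m y, (m <= p)%nat -> Derive_n (fun x => v x y) (2 * m) 0 = 0.
Proof.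
  revert v; induction p as [|p IH]; intros v Hv H m y Hm.
  - replace m with 0%nat by lia; apply (H 0%nat); lia.
  - destruct m as [|m]; [apply (H 0%nat); lia|].
    replace (2 * S m)%nat with (S (S (2 * m))) by lia.
    rewrite <- !Derive_n_Derive.
    apply (IH (Dx (Dx v))); [now apply bipoly_Dx, bipoly_Dx| |lia].
    intros nu z Hnu.
    rewrite !(iter_laplacian_Dx n) by (try apply bipoly_Dx; exact Hv).
    assert (E := H (S nu) z ltac:(lia)); simpl in E; rewrite laplacian_eq in E.
    unfold add2 in E; rewrite Dy_Dy_zero_on_axis in E; [lra|].
    intros; apply H; lia.
Qed.

(** The degree in [x] is at most [2p], so the even orders [0, 2, ..., 2p] that the powers [nu <= p]
    control are all the even orders there are. *)
Lemma bipoly_odd (p : nat) (v : R -> R -> R) :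
  bipoly (S (2 * p)) v ->
  (forall nu y, (nu <= p)%nat -> Nat.iter nu laplacian v 0 y = 0) ->
  forall x y, v (- x) y = - v x y.
Proof.
  intros Hv H x y.
  rewrite (is_poly_parity (S (2 * p)) (fun x => v x y) 0).
  - simpl; ring.
  - apply bipoly_slice_x, Hv.
  - intros m Hm; rewrite Nat.add_0_r.
    apply (Derive_even_zero_on_axis (S (2 * p)) p); [exact Hv|exact H|lia].
  - lia.
Qed.

Lemma bipoly_even (p : nat) (v : R -> R -> R) :
  bipoly (S (2 * p)) v ->
  (forall nu y, (nu < p)%nat -> Dx (Nat.iter nu laplacian v) 0 y = 0) ->
  forall x y, v (- x) y = v x y.
Proof.
  intros Hv H x y.
  rewrite (is_poly_parity (S (2 * p)) (fun x => v x y) 1).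
  - simpl; ring.
  - apply bipoly_slice_x, Hv.
  (* Odd derivatives of [v] are even derivatives of [Dx v]; the orders [1, 3, ..., 2p - 1] need the
     powers up to [p - 1]. *)
  - intros m Hm; rewrite Nat.add_1_r, <- Derive_n_Derive.
    apply (Derive_even_zero_on_axis (S (2 * p)) (p - 1) (Dx v));
      [apply bipoly_Dx, Hv| |lia].
    intros nu z Hnu; rewrite (iter_laplacian_Dx (S (2 * p))) by exact Hv.
    apply H; lia.
  - lia.
Qed.

(** * Reduction of the four faces to the axis [x = 0] *)

(* [pull F v] is [v] in coordinates (distance from the face, tangential). *)
Definition pull (F : face) (v : R -> R -> R) : R -> R -> R :=
  match F with
  | Left => v
  | Right => fun x y => v (1 - x) y
  | Bottom => fun x y => v y x
  | Top => fun x y => v y (1 - x)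
  end.

Definition cross_size (F : face) (Nx Ny : nat) : nat :=
  match F with Left | Right => Nx | Bottom | Top => Ny end.

Lemma trace_pull (F : face) (v : R -> R -> R) (s : R) :
  trace F v s = pull F v 0 s.
Proof. destruct F; simpl; rewrite ?Rminus_0_r; reflexivity. Qed.

Lemma value_at_pull (F : face) (Nx Ny : nat) (v : R -> R -> R) (n k : Z) :
  (1 <= Nx)%nat -> (1 <= Ny)%nat ->
  value_at Nx Ny v (node F Nx Ny n k)
    = pull F v (coord (cross_size F Nx Ny) n) (tangential_coord F Nx Ny k).
Proof.
  intros Hx Hy.
  (* The far face, at index [N], has coordinate [N * (1 / N) = 1], which requires [N] to be
     nonzero. *)
  assert (E : forall N, (1 <= N)%nat -> coord N (Z.of_nat N - n) = 1 - coord N n).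
  { intros N HN; unfold coord; rewrite minus_IZR, <- INR_IZR_INZ.
    field; apply not_0_INR; lia. }
  destruct F; unfold value_at, tangential_coord; simpl; rewrite ?E by assumption;
    reflexivity.
Qed.

Lemma bipoly_reflect (n : nat) (v : R -> R -> R) :
  bipoly n v -> bipoly n (fun x y => v (1 - x) y).
Proof.
  induction 1 as [a b Ha Hb|v w _ IHv _ IHw].
  - apply (bipoly_tensor n (fun x => a (1 - x)) b); [|assumption].
    now apply is_poly_reflect.
  - exact (bipoly_add n _ _ IHv IHw).
Qed.

Lemma bipoly_pull (n : nat) (F : face) (v : R -> R -> R) :
  bipoly n v -> bipoly n (pull F v).
Proof.
  intros H; destruct F; simpl.
  - exact H.
  - apply bipoly_reflect, H.
  - apply bipoly_swap, H.
  - exact (bipoly_reflect n _ (bipoly_swap n v H)).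
Qed.

Lemma Dx_reflect (n : nat) (v : R -> R -> R) (x y : R) :
  bipoly n v -> Dx (fun x y => v (1 - x) y) x y = - Dx v (1 - x) y.
Proof.
  intros H.
  apply (Derive_reflect 1 (fun z => v z y)), (bipoly_ex_derive_x n), H.
Qed.

(** Each [x]-derivative brings a factor -1 under the reflection, and two of them cancel. *)
Lemma laplacian_reflect (n : nat) (v : R -> R -> R) :
  bipoly n v ->
  laplacian (fun x y => v (1 - x) y) = fun x y => laplacian v (1 - x) y.
Proof.
  intros H; rewrite !laplacian_eq; apply fun2_ext; intros x y; unfold add2.
  f_equal.
  replace (Dx (fun x y => v (1 - x) y)) with (fun x y => - Dx v (1 - x) y).
  - unfold Dx at 1; rewrite Derive_opp.
    change (- Dx (fun x y => Dx v (1 - x) y) x y = Dx (Dx v) (1 - x) y).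
    rewrite (Dx_reflect n) by apply bipoly_Dx, H; ring.
  - apply fun2_ext; intros; symmetry; apply (Dx_reflect n), H.
Qed.

Lemma laplacian_swap (v : R -> R -> R) :
  laplacian (fun x y => v y x) = fun x y => laplacian v y x.
Proof. apply fun2_ext; intros x y; apply Rplus_comm. Qed.

Lemma laplacian_pull (n : nat) (F : face) (v : R -> R -> R) :
  bipoly n v -> laplacian (pull F v) = pull F (laplacian v).
Proof.
  intros H; destruct F; simpl.
  - reflexivity.
  - apply (laplacian_reflect n), H.
  - apply laplacian_swap.
  - rewrite (laplacian_reflect n (fun x y => v y x)) by apply bipoly_swap, H.
    now rewrite laplacian_swap.
Qed.

Lemma iter_laplacian_pull (n nu : nat) (F : face) (v : R -> R -> R) :
  bipoly n v ->
  Nat.iter nu laplacian (pull F v) = pull F (Nat.iter nu laplacian v).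
Proof.
  intros H; induction nu as [|nu IH]; [reflexivity|].
  simpl; rewrite IH; apply (laplacian_pull n), bipoly_iter_laplacian, H.
Qed.

(** [Dcross] points along the positive axis, so on the right and top faces the two derivatives
    differ in sign. Vanishing is insensitive to that, and is all that the homogeneous problem calls
    for. *)
Lemma Dx_pull_zero (n : nat) (F : face) (v : R -> R -> R) (s : R) :
  bipoly n v -> trace F (Dcross F v) s = 0 -> Dx (pull F v) 0 s = 0.
Proof.
  intros H; destruct F; simpl; intros H0.
  - exact H0.
  - rewrite (Dx_reflect n), Rminus_0_r by exact H; unfold Dx; rewrite H0; ring.
  - exact H0.
  - rewrite (Dx_reflect n (fun x y => v y x)), Rminus_0_r by apply bipoly_swap, H.
    unfold Dx; rewrite H0; ring.
Qed.

Lemma bipoly_Dcross (n : nat) (F : face) (v : R -> R -> R) :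
  bipoly n v -> bipoly n (Dcross F v).
Proof. intros H; destruct F; (apply bipoly_Dx || apply bipoly_Dy); exact H. Qed.

Lemma trace_is_poly (n : nat) (F : face) (v : R -> R -> R) :
  bipoly n v -> is_poly n (trace F v).
Proof.
  intros H; apply (is_poly_ext n (pull F v 0)).
  - intros s; symmetry; apply trace_pull.
  - apply bipoly_slice_y, bipoly_pull, H.
Qed.

(** * Passage from coefficients to tensor sums, and vanishing of the homogeneous data *)

Lemma bipoly_sum (n d : nat) (v : nat -> R -> R -> R) :
  (forall m, (m <= d)%nat -> bipoly n (v m)) ->
  bipoly n (fun x y => sum_f_R0 (fun m => v m x y) d).
Proof.
  induction d as [|d IH]; simpl; intros H.
  - apply H; lia.
  - apply (bipoly_add n (fun x y => sum_f_R0 (fun m => v m x y) d)); auto.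
Qed.

Lemma bipoly_of_is_bipoly (d : nat) (v : R -> R -> R) :
  is_bipoly d v -> bipoly (S d) v.
Proof.
  intros [c Hc]; apply fun2_ext in Hc; rewrite Hc.
  apply (bipoly_sum (S d) d
           (fun m x y => sum_f_R0 (fun n => c m n * x ^ m * y ^ n) d)).
  intros m Hm; apply (bipoly_sum (S d) d (fun n x y => c m n * x ^ m * y ^ n)).
  intros n Hn.
  apply (bipoly_tensor (S d) (fun x => c m n * x ^ m) (fun y => y ^ n)).
  - apply is_poly_scal, (is_poly_le (S m)); [lia|apply is_poly_pow].
  - apply (is_poly_le (S n)); [lia|apply is_poly_pow].
Qed.

Lemma iter_laplacian_zero (nu : nat) :
  Nat.iter nu laplacian (fun _ _ => 0) = fun _ _ => 0.
Proof.
  induction nu as [|nu IH]; [reflexivity|].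
  simpl; rewrite IH; apply fun2_ext; intros x y; unfold laplacian.
  rewrite !Derive_n_zero; ring.
Qed.

Lemma trace_zero (F : face) (s : R) : trace F (fun _ _ => 0) s = 0.
Proof. now destruct F. Qed.

Lemma Dcross_zero (F : face) : Dcross F (fun _ _ => 0) = fun _ _ => 0.
Proof. apply fun2_ext; intros; destruct F; simpl; apply Derive_const. Qed.

Lemma Psi_zero (q nu : nat) (t : R) :
  Psi laplacian q (fun _ _ _ => 0) nu t = fun _ _ => 0.
Proof.
  apply fun2_ext; intros x y; unfold Psi.
  rewrite (sum_n_m_ext _ (fun _ => (zero : R_AbelianMonoid)));
    [exact (sum_n_m_const_zero (G := R_AbelianMonoid) 1 nu)|].
  intros m; replace (fun x' y' : R => Derive_n (fun _ => 0) (q * (nu - m)) t)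
    with (fun _ _ : R => 0)
    by (apply fun2_ext; intros; symmetry; apply Derive_n_zero).
  now rewrite iter_laplacian_zero.
Qed.

Lemma dirichlet_data_zero (q : nat) (F : face) (nu : nat) (t s : R) :
  dirichlet_data laplacian q (fun _ _ _ => 0) F (fun _ _ => 0) nu t s = 0.
Proof.
  unfold dirichlet_data; rewrite Psi_zero, iter_laplacian_zero, trace_zero.
  destruct q; [|rewrite Derive_n_zero]; ring.
Qed.

Lemma neumann_data_zero (q : nat) (F : face) (nu : nat) (t s : R) :
  neumann_data laplacian q (fun _ _ _ => 0) F (fun _ _ => 0) nu t s = 0.
Proof.
  unfold neumann_data.
  rewrite Psi_zero, iter_laplacian_zero, Dcross_zero, trace_zero.
  destruct nu, q; rewrite ?Derive_n_zero; ring.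
Qed.

(** A polynomial of degree at most [2d] with zeros at [2d + 1] distinct grid points is zero. *)
Lemma trace_zero_of_grid (d : nat) (F : face) (Nx Ny : nat) (v : R -> R -> R)
    (k : Z) :
  bipoly (S (2 * d)) v -> (1 <= tangential_size F Nx Ny)%nat ->
  (forall j : Z, (- Z.of_nat d <= j <= Z.of_nat d)%Z ->
     trace F v (tangential_coord F Nx Ny (k + j)) = 0) ->
  forall s, trace F v s = 0.
Proof.
  intros Hv HN H.
  apply (is_poly_eq_zero_roots (S (2 * d)) _
    (fun i => tangential_coord F Nx Ny (k + (Z.of_nat i - Z.of_nat d)))).
  - apply trace_is_poly, Hv.
  - intros i; unfold tangential_coord, coord; apply Rmult_lt_compat_r.
    + apply Rdiv_lt_0_compat; [lra|]; apply lt_0_INR; lia.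
    + apply IZR_lt; lia.
  - intros i Hi; apply H; lia.
Qed.

Lemma coord_opp (N : nat) (i : Z) : coord N (- i) = - coord N i.
Proof. unfold coord; rewrite opp_IZR; ring. Qed.

Theorem theorem3 (p Nx Ny q : nat) (F : face)
    (f : R -> R -> R -> R) (g : R -> R -> R) (t : R) (U : Z -> Z -> R) (k : Z)
    (hp : (1 <= p)%nat) (hNx : (1 <= Nx)%nat) (hNy : (1 <= Ny)%nat)
    (hq : (q <= 2)%nat)
    (hk : (Z.of_nat p <= k
             <= Z.of_nat (tangential_size F Nx Ny) - Z.of_nat p)%Z)
    (hf : forall x y s : R, f x y s = 0)
    (hg : forall y s : R, g y s = 0) :
  (lcbc_ghost_values laplacian q f F g p Nx Ny t U k Dirichlet ->
     forall i : Z, (1 <= i <= Z.of_nat p)%Z ->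
       grid_value U (node F Nx Ny (- i) k)
         = - grid_value U (node F Nx Ny i k))
  /\ (lcbc_ghost_values laplacian q f F g p Nx Ny t U k Neumann ->
     forall i : Z, (1 <= i <= Z.of_nat p)%Z ->
       grid_value U (node F Nx Ny (- i) k)
         = grid_value U (node F Nx Ny i k)).
Proof.
  (* With [f] and [g] literally the zero functions, the lemmas on vanishing data apply by
     rewriting. *)
  replace f with (fun _ _ _ : R => 0)
    by (apply functional_extensionality; intros x; apply fun2_ext; intros;
        now rewrite hf).
  replace g with (fun _ _ : R => 0) by (apply fun2_ext; intros; now rewrite hg).
  split; intros [u [[Hu Hc] Hghost]] i Hi; apply bipoly_of_is_bipoly in Hu.
  - destruct Hc as [Hface [Hint Hcomp]].
    (* Tangential offset 0: the mirror image of the ghost point is an interior data point on the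
       same transversal grid line, so the claim becomes a parity of [u]. *)
    assert (Hval := Hint i 0%Z Hi ltac:(lia)); rewrite Z.add_0_r in Hval.
    rewrite Hghost, <- Hval, !value_at_pull, coord_opp by assumption.
    apply (bipoly_odd p); [apply bipoly_pull, Hu|].
    intros nu s Hnu; rewrite (iter_laplacian_pull _ nu F u Hu), <- trace_pull.
    (* For [nu = 0] the vanishing comes from interpolation of the boundary values along the face;
       for [nu >= 1] it comes from the compatibility conditions at one point. *)
    destruct nu as [|nu].
    + apply (trace_zero_of_grid p F Nx Ny u k Hu); [destruct F; assumption|].
      intros j Hj; specialize (Hface j Hj).
      rewrite value_at_pull in Hface by assumption.
      unfold coord in Hface; rewrite Rmult_0_l in Hface.
      now rewrite trace_pull.
    + apply (is_poly_eq_zero_taylor (S (2 * p)) _ (tangential_coord F Nx Ny k)).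
      * apply trace_is_poly, bipoly_iter_laplacian, Hu.
      * intros mu Hmu; rewrite Hcomp by lia.
        rewrite (Derive_n_ext _ (fun _ => 0)); [apply Derive_n_zero|].
        intros; apply dirichlet_data_zero.
  - destruct Hc as [Hint Hcomp].
    assert (Hval := Hint i 0%Z ltac:(lia) ltac:(lia)); rewrite Z.add_0_r in Hval.
    rewrite Hghost, <- Hval, !value_at_pull, coord_opp by assumption.
    apply (bipoly_even p); [apply bipoly_pull, Hu|].
    intros nu s Hnu; rewrite (iter_laplacian_pull _ nu F u Hu).
    apply (Dx_pull_zero (S (2 * p))); [apply bipoly_iter_laplacian, Hu|].
    (* The boundary condition itself is the case [nu = 0] of the derivative conditions, so all
       [nu < p] are treated alike. *)
    apply (is_poly_eq_zero_taylor (S (2 * p)) _ (tangential_coord F Nx Ny k)).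
    + apply trace_is_poly, bipoly_Dcross, bipoly_iter_laplacian, Hu.
    + intros mu Hmu; rewrite Hcomp by lia.
      rewrite (Derive_n_ext _ (fun _ => 0)); [apply Derive_n_zero|].
      intros; apply neumann_data_zero.
Qed.
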